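(* Let $\mathcal B$, $\hat{\mathcal B}$ be two bicategories and let $(|\mathcal G|,\mathcal G_*,\widehat{\mathcal G}_* )$ be a unitary pseudofunctor between them (from $\mathcal B$ to $\hat{\mathcal B}$). Then for any pair of objects of the category $\mathcal Cat(|\mathcal G|,\mathcal G_*,c_*,\hat c_*,\widehat{\mathcal G}_*,\alpha_*,\hat\alpha_* )$, whose objects are the $\mathcal G$-iterates and whose morphisms are the canonical ones, there is at most one morphism.
   Context: Conventions. In a bicategory $\mathcal B$, $c_{X,Y,Z}:\mathcal B(X,Y)\times\mathcal B(Y,Z)\to\mathcal B(X,Z)$ are the composition functors (written $\circ$ on 1-morphisms and, as horizontal composition, on 2-morphisms), $\cdot$ is vertical composition of 2-morphisms, $\alpha_{h,g,f}:h\circ(g\circ f)\Rightarrow(h\circ g)\circ f$ are the associators, and $\lambda_f:id_Y\circ f\Rightarrow f$, $\rho_f:f\circ id_X\Rightarrow f$ are the unit constraints. The corresponding data of $\hat{\mathcal B}$ are $\hat c$, $\hat\alpha$, $\hat\lambda$, $\hat\rho$. A subscript $*$ denotes the whole family of such data, indexed by objects. A pseudofunctor $\mathcal G:\mathcal B\to\hat{\mathcal B}$ consists of an object map $|\mathcal G|$, functors $\mathcal G_{X,Y}:\mathcal B(X,Y)\to\hat{\mathcal B}(\mathcal G(X),\mathcal G(Y))$, 2-isomorphisms $\widehat{\mathcal G}(g,f):\mathcal G(g)\circ\mathcal G(f)\Rightarrow\mathcal G(g\circ f)$ natural in $(f,g)$, and 2-isomorphisms $\mathcal G_0(X):\mathcal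 G(id_X)\Rightarrow id_{\mathcal G(X)}$, satisfying the hexagonal axiom $\mathcal G(\alpha_{h,g,f})\cdot\widehat{\mathcal G}(h,g\circ f)\cdot(1_{\mathcal G(h)}\circ\widehat{\mathcal G}(g,f))=\widehat{\mathcal G}(h\circ g,f)\cdot(\widehat{\mathcal G}(h,g)\circ1_{\mathcal G(f)})\cdot\hat\alpha_{\mathcal G(h),\mathcal G(g),\mathcal G(f)}$ and, for $f:X\to Y$, the triangular axioms $\hat\rho_{\mathcal G(f)}\cdot(1_{\mathcal G(f)}\circ\mathcal G_0(X))=\mathcal G(\rho_f)\cdot\widehat{\mathcal G}(f,id_X)$ and $\hat\lambda_{\mathcal G(f)}\cdot(\mathcal G_0(Y)\circ1_{\mathcal G(f)})=\mathcal G(\lambda_f)\cdot\widehat{\mathcal G}(id_Y,f)$. It is unitary if all $\mathcal G_0(X)$ are identities; it is then written $(|\mathcal G|,\mathcal G_*,\widehat{\mathcal G}_* )$. $\mathcal G$-iterates. The $\mathcal G$-iterates of multiplicity $n$, $n\ge2$, are the functors $\mathcal B(X_1,X_2)\times\mathcal B(X_2,X_3)\times\cdots\times\mathcal B(X_n,X_{n+1})\to\hat{\mathcal B}(\mathcal G(X_1),\mathcal G(X_{n+1}))$, indexed by a collection $X_1,\dots,X_{n+1}$ of $n+1$ objects of $\mathcal B$, that are obtained as compositions of product functors $\mathcal G_{X_i,X_{i+1}}\times\mathcal G_{X_{i+1},X_{i+2}}\times\cdots\times\mathcal G_{X_j,X_{j+1}}$ with suitable iterates of the composition functors $c_{X,Y,Z}$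 and $\hat c_{U,V,W}$. So a generic $\mathcal G$-iterate sends $n$ composable 1-morphisms to a composite in $\hat{\mathcal B}$ of images under $\mathcal G$ of composites in $\mathcal B$ of consecutive blocks of these 1-morphisms, parenthesized according to the composition functors used. The category. A canonical 2-morphism is any 2-morphism (actually a 2-isomorphism) obtained as a vertical composition of expansions of instances of the given $\widehat{\mathcal G}_{X,Y,Z}$, $\alpha$, $\hat\alpha$ or their inverses, for all objects of $\mathcal B$ and of $\hat{\mathcal B}$, where an expansion of a 2-morphism means its horizontal composition with identity 2-morphisms (associators $\alpha$ of $\mathcal B$ enter through their images under $\mathcal G$). Let $\mathcal Cat(|\mathcal G|,\mathcal G_*,c_*,\hat c_* )$ be the category whose objects are all the $\mathcal G$-iterates and whose morphisms are all natural transformations between them. Then $\mathcal Cat(|\mathcal G|,\mathcal G_*,c_*,\hat c_*,\widehat{\mathcal G}_*,\alpha_*,\hat\alpha_* )$ is the subcategory with the same objects but whose morphisms are only the canonical ones, i.e. those induced by $\widehat{\mathcal G}_*,\alpha_*,\hat\alpha_*$. *)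

(* Defs.v *)
From Stdlib Require Import FunctionalExtensionality ProofIrrelevance.
From mathcomp Require Import all_boot.

Set Implicit Arguments.
Unset Strict Implicit.
Unset Printing Implicit Defensive.

Declare Scope cat_scope.
Delimit Scope cat_scope with cat.
Local Open Scope cat_scope.
#[local] Obligation Tactic := idtac.

Record Category := {
  Ob :> Type;
  Hom : Ob -> Ob -> Type;
  idc : forall a, Hom a a;
  comp : forall a b c, Hom b c -> Hom a b -> Hom a c;
  comp_idl : forall a b (f : Hom a b), comp (idc b) f = f;
  comp_idr : forall a b (f : Hom a b), comp f (idc a) = f;
  comp_assoc : forall a b c d (h : Hom c d) (g : Hom b c) (f : Hom a b),
    comp h (comp g f) = comp (comp h g) f
}.
Arguments Hom {_} _ _.
Arguments idc {_} _.
Arguments comp {_ _ _ _} _ _.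

(* In a category of 1-morphisms this is the vertical composition. *)
Notation "g · f" := (comp g f) (at level 40, left associativity) : cat_scope.

Record Iso (C : Category) (a b : C) := {
  iso_hom :> Hom a b;
  iso_inv : Hom b a;
  iso_homK : iso_inv · iso_hom = idc a;
  iso_invK : iso_hom · iso_inv = idc b
}.

(* [is_identity f] for [f : Hom a b] includes the equality of [a] and [b]. *)
Inductive is_identity (C : Category) (a : C) : forall b : C, Hom a b -> Prop :=
  is_identity_idc : is_identity (idc a).

Record Functor (C D : Category) := {
  fobj :> C -> D;
  fmap : forall a b, Hom a b -> Hom (fobj a) (fobj b);
  fmap_id : forall a, fmap (idc a) = idc (fobj a);
  fmap_comp : forall a b c (g : Hom b c) (f : Hom a b),
    fmap (g · f) = fmap g · fmap f
}.
Arguments fmap {_ _} _ {_ _} _.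

Record NatTrans (C D : Category) (F G : Functor C D) := {
  ntc :> forall a, Hom (F a) (G a);
  nt_natural : forall a b (f : Hom a b), fmap G f · ntc a = ntc b · fmap F f
}.

Lemma nat_trans_eq (C D : Category) (F G : Functor C D) (p q : NatTrans F G) :
  (forall a, p a = q a) -> p = q.
Proof.
case: p q => [p hp] [q hq] /= e.
have {}e : p = q by apply: functional_extensionality_dep.
by case: _ / e hq => hq; congr Build_NatTrans; apply: proof_irrelevance.
Qed.

Program Definition functor_comp (C D E : Category) (G : Functor D E)
    (F : Functor C D) : Functor C E :=
  {| fobj := fun a => G (F a); fmap := fun a b f => fmap G (fmap F f) |}.
Next Obligation. by move=> * /=; rewrite !fmap_id. Qed.
Next Obligation. by move=> * /=; rewrite !fmap_comp. Qed.

Program Definition prod_cat (C D : Category) : Category :=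
  {| Ob := (C * D)%type;
     Hom := fun a b => (Hom a.1 b.1 * Hom a.2 b.2)%type;
     idc := fun a => (idc a.1, idc a.2);
     comp := fun a b c g f => (g.1 · f.1, g.2 · f.2) |}.
Next Obligation. by move=> C D a b [f g] /=; rewrite !comp_idl. Qed.
Next Obligation. by move=> C D a b [f g] /=; rewrite !comp_idr. Qed.
Next Obligation. by move=> * /=; rewrite !comp_assoc. Qed.

Program Definition functor_pair (C D E : Category) (F : Functor C D)
    (G : Functor C E) : Functor C (prod_cat D E) :=
  {| fobj := fun a => (F a, G a) : prod_cat D E;
     fmap := fun a b f => (fmap F f, fmap G f) |}.
Next Obligation. by move=> * /=; rewrite !fmap_id. Qed.
Next Obligation. by move=> * /=; rewrite !fmap_comp. Qed.

Program Definition pi_cat (I : Type) (C : I -> Category) : Category :=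
  {| Ob := forall i, C i;
     Hom := fun a b => forall i, Hom (a i) (b i);
     idc := fun a i => idc (a i);
     comp := fun a b c g f i => g i · f i |}.
Next Obligation.
by move=> * /=; apply: functional_extensionality_dep => i; apply: comp_idl.
Qed.
Next Obligation.
by move=> * /=; apply: functional_extensionality_dep => i; apply: comp_idr.
Qed.
Next Obligation.
by move=> * /=; apply: functional_extensionality_dep => i; apply: comp_assoc.
Qed.

Program Definition pi_proj (I : Type) (C : I -> Category) (i : I) :
    Functor (pi_cat C) (C i) :=
  {| fobj := fun a => a i; fmap := fun a b f => f i |}.
Next Obligation. by []. Qed.
Next Obligation. by []. Qed.

Program Definition nt_id (C D : Category) (F : Functor C D) : NatTrans F F :=
  {| ntc := fun a => idc (F a) |}.
Next Obligation. by move=> * /=; rewrite comp_idl comp_idr. Qed.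

Program Definition nt_comp (C D : Category) (F G H : Functor C D)
    (q : NatTrans G H) (p : NatTrans F G) : NatTrans F H :=
  {| ntc := fun a => q a · p a |}.
Next Obligation.
by move=> * /=; rewrite comp_assoc nt_natural -!comp_assoc nt_natural.
Qed.

Program Definition nt_image (C D E : Category) (K : Functor D E)
    (F G : Functor C D) (p : NatTrans F G) :
    NatTrans (functor_comp K F) (functor_comp K G) :=
  {| ntc := fun a => fmap K (p a) |}.
Next Obligation. by move=> * /=; rewrite -!fmap_comp nt_natural. Qed.

Program Definition nt_pair (C D E : Category) (F F' : Functor C D)
    (G G' : Functor C E) (p : NatTrans F F') (q : NatTrans G G') :
    NatTrans (functor_pair F G) (functor_pair F' G') :=
  {| ntc := fun a =>
       (p a, q a) : @Hom (prod_cat D E) (F a, G a) (F' a, G' a) |}.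
Next Obligation. by move=> * /=; rewrite !nt_natural. Qed.

(* The category with objects [T], each standing for a functor [ev t], and with
   all natural transformations between these functors as morphisms. *)
Program Definition nat_cat (C D : Category) (T : Type) (ev : T -> Functor C D) :
    Category :=
  {| Ob := T;
     Hom := fun s t => NatTrans (ev s) (ev t);
     idc := fun s => nt_id (ev s);
     comp := fun s t u q p => nt_comp q p |}.
Next Obligation.
by move=> * /=; apply: nat_trans_eq => x /=; rewrite comp_idl.
Qed.
Next Obligation.
by move=> * /=; apply: nat_trans_eq => x /=; rewrite comp_idr.
Qed.
Next Obligation.
by move=> * /=; apply: nat_trans_eq => x /=; rewrite comp_assoc.
Qed.

Lemma sig_ext (T : Type) (P : T -> Prop) (x y : {z | P z}) :
  proj1_sig x = proj1_sig y -> x = y.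
Proof.
case: x y => [x px] [y py] /= e; case: _ / e py => py.
by congr exist; apply: proof_irrelevance.
Qed.

Program Definition wide_subcat (C : Category)
    (P : forall a b : C, Hom a b -> Prop)
    (Pid : forall a, P a a (idc a))
    (Pcomp : forall a b c (g : Hom b c) (f : Hom a b),
       P b c g -> P a b f -> P a c (g · f)) : Category :=
  {| Ob := C;
     Hom := fun a b => {f : Hom a b | P a b f};
     idc := fun a => exist _ (idc a) (Pid a);
     comp := fun a b c g f =>
       exist _ (proj1_sig g · proj1_sig f)
               (Pcomp _ _ _ _ _ (proj2_sig g) (proj2_sig f)) |}.
Next Obligation. by move=> * /=; apply: sig_ext; apply: comp_idl. Qed.
Next Obligation. by move=> * /=; apply: sig_ext; apply: comp_idr. Qed.
Next Obligation. by move=> * /=; apply: sig_ext; apply: comp_assoc. Qed.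

(* Disjoint union: a morphism requires both objects in the same summand. *)
Section Coproduct.
Variables (I : Type) (C : I -> Category).

Definition coprod_hom (x y : {i & C i}) : Type :=
  {e : projT1 x = projT1 y & Hom (eq_rect _ C (projT2 x) _ e) (projT2 y)}.

Definition coprod_comp x y z (g : coprod_hom y z) (f : coprod_hom x y) :
  coprod_hom x z.
Proof.
case: x y z g f => [i a] [j b] [k c] [/= e' g] [/= e f].
by case: _ / e' c g => c g; case: _ / e b c f g => b c f g; exists erefl; exact: (g · f).
Defined.

Program Definition coprod_cat : Category :=
  {| Ob := {i & C i}; Hom := coprod_hom;
     idc := fun x => existT _ erefl (idc (projT2 x)); comp := coprod_comp |}.
Next Obligation.
by case=> [i a] [j b] [/= e f]; case: _ / e b f => b f /=; rewrite comp_idl.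
Qed.
Next Obligation.
by case=> [i a] [j b] [/= e f]; case: _ / e b f => b f /=; rewrite comp_idr.
Qed.
Next Obligation.
case=> [i a] [j b] [k c] [l d] [/= e'' h] [/= e' g] [/= e f].
case: _ / e'' d h => d h; case: _ / e' c d g h => c d g h.
by case: _ / e b c d f g h => b c d f g h /=; rewrite comp_assoc.
Qed.

End Coproduct.

Record BicategoryData := {
  bob :> Type;
  bhom : bob -> bob -> Category;
  bcomp : forall X Y Z : bob,
    Functor (prod_cat (bhom X Y) (bhom Y Z)) (bhom X Z);
  bid : forall X : bob, bhom X X
}.
Arguments bhom {_} _ _.
Arguments bcomp {_} _ _ _.
Arguments bid {_} _.

Definition hcomp1 (B : BicategoryData) (X Y Z : B) (g : bhom Y Z)
    (f : bhom X Y) : bhom X Z :=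
  bcomp X Y Z (f, g).

Definition hcomp2 (B : BicategoryData) (X Y Z : B) (g g' : bhom Y Z)
    (f f' : bhom X Y) (b : Hom g g') (a : Hom f f') :
    Hom (hcomp1 g f) (hcomp1 g' f') :=
  fmap (bcomp X Y Z)
    ((a, b) : @Hom (prod_cat (bhom X Y) (bhom Y Z)) (f, g) (f', g')).

Notation "g ∘ f" := (hcomp1 g f) (at level 38, right associativity) : cat_scope.
Notation "b ∗ a" := (hcomp2 b a) (at level 38, right associativity) : cat_scope.

Record Bicategory := {
  bdata :> BicategoryData;
  assoc : forall (X Y Z W : bdata) (h : bhom Z W) (g : bhom Y Z) (f : bhom X Y),
    Iso (h ∘ (g ∘ f)) ((h ∘ g) ∘ f);
  lunit : forall (X Y : bdata) (f : bhom X Y), Iso (bid Y ∘ f) f;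
  runit : forall (X Y : bdata) (f : bhom X Y), Iso (f ∘ bid X) f;
  assoc_natural : forall (X Y Z W : bdata) (h h' : bhom Z W) (g g' : bhom Y Z)
      (f f' : bhom X Y) (w : Hom h h') (v : Hom g g') (u : Hom f f'),
    ((w ∗ v) ∗ u) · assoc h g f = assoc h' g' f' · (w ∗ (v ∗ u));
  lunit_natural : forall (X Y : bdata) (f f' : bhom X Y) (u : Hom f f'),
    u · lunit f = lunit f' · (idc (bid Y) ∗ u);
  runit_natural : forall (X Y : bdata) (f f' : bhom X Y) (u : Hom f f'),
    u · runit f = runit f' · (u ∗ idc (bid X));
  pentagon : forall (X Y Z W V : bdata) (k : bhom W V) (h : bhom Z W)
      (g : bhom Y Z) (f : bhom X Y),
    assoc (k ∘ h) g f · assoc k h (g ∘ f) =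
    (assoc k h g ∗ idc f) · assoc k (h ∘ g) f · (idc k ∗ assoc h g f);
  triangle : forall (X Y Z : bdata) (g : bhom Y Z) (f : bhom X Y),
    (runit g ∗ idc f) · assoc g (bid Y) f = idc g ∗ lunit f
}.
Arguments assoc {_ _ _ _ _} _ _ _.
Arguments lunit {_ _ _} _.
Arguments runit {_ _ _} _.

Record Pseudofunctor (B B' : Bicategory) := {
  pob :> B -> B';
  pmap : forall X Y : B, Functor (bhom X Y) (bhom (pob X) (pob Y));
  pcomp : forall (X Y Z : B) (g : bhom Y Z) (f : bhom X Y),
    Iso (pmap Y Z g ∘ pmap X Y f) (pmap X Z (g ∘ f));
  punit : forall X : B, Iso (pmap X X (bid X)) (bid (pob X));
  pcomp_natural : forall (X Y Z : B) (g g' : bhom Y Z) (f f' : bhom X Y)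
      (v : Hom g g') (u : Hom f f'),
    fmap (pmap X Z) (v ∗ u) · pcomp g f =
    pcomp g' f' · (fmap (pmap Y Z) v ∗ fmap (pmap X Y) u);
  phexagon : forall (X Y Z W : B) (h : bhom Z W) (g : bhom Y Z) (f : bhom X Y),
    fmap (pmap X W) (assoc h g f) · pcomp h (g ∘ f)
      · (idc (pmap Z W h) ∗ pcomp g f) =
    pcomp (h ∘ g) f · (pcomp h g ∗ idc (pmap X Y f))
      · assoc (pmap Z W h) (pmap Y Z g) (pmap X Y f);
  prunit : forall (X Y : B) (f : bhom X Y),
    runit (pmap X Y f) · (idc (pmap X Y f) ∗ punit X) =
    fmap (pmap X Y) (runit f) · pcomp f (bid X);
  plunit : forall (X Y : B) (f : bhom X Y),
    lunit (pmap X Y f) · (punit Y ∗ idc (pmap X Y f)) =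
    fmap (pmap X Y) (lunit f) · pcomp (bid Y) f
}.
Arguments pmap {_ _} _ _ _.
Arguments pcomp {_ _} _ {_ _ _} _ _.
Arguments punit {_ _} _ _.

Definition unitary (B B' : Bicategory) (G : Pseudofunctor B B') : Prop :=
  forall X : B, is_identity (punit G X).

(* Parenthesizations of the arrows [i -> i.+1], [k <= i < l], between the
   vertices [k] and [l] of the path [0 -> 1 -> ... -> n].  An iterate of the
   composition functors is determined by such a parenthesization.
   [BNode s t] is "first [s], then [t]". *)
Inductive biter (n : nat) : 'I_n.+1 -> 'I_n.+1 -> Type :=
  | BLeaf (i : 'I_n) : biter (widen_ord (leqnSn n) i) (lift ord0 i)
  | BNode (k j l : 'I_n.+1) : biter k j -> biter j l -> biter k l.

(* The same with two levels: a parenthesization in the target bicategory of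
   images [GLeaf s] of parenthesizations [s] in the source bicategory. *)
Inductive giter (n : nat) : 'I_n.+1 -> 'I_n.+1 -> Type :=
  | GLeaf (k l : 'I_n.+1) : biter k l -> giter k l
  | GNode (k j l : 'I_n.+1) : giter k j -> giter j l -> giter k l.

(* [B(X_0, X_1) x ... x B(X_(n-1), X_n)] *)
Definition path_cat (B : BicategoryData) (n : nat) (X : 'I_n.+1 -> B) :
    Category :=
  pi_cat (fun i : 'I_n => bhom (X (widen_ord (leqnSn n) i)) (X (lift ord0 i))).

Section CompositionNaturality.
Variables (B : Bicategory) (C : Category).

Definition hcompF (X Y Z : B) (G : Functor C (bhom Y Z))
    (F : Functor C (bhom X Y)) : Functor C (bhom X Z) :=
  functor_comp (bcomp X Y Z) (functor_pair F G).

Definition nt_hcomp (X Y Z : B) (G G' : Functor C (bhom Y Z))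
    (F F' : Functor C (bhom X Y)) (q : NatTrans G G') (p : NatTrans F F') :
    NatTrans (hcompF G F) (hcompF G' F') :=
  nt_image (bcomp X Y Z) (nt_pair p q).

Program Definition nt_assoc (X Y Z W : B) (H : Functor C (bhom Z W))
    (G : Functor C (bhom Y Z)) (F : Functor C (bhom X Y)) :
    NatTrans (hcompF H (hcompF G F)) (hcompF (hcompF H G) F) :=
  {| ntc := fun x => assoc (H x) (G x) (F x) |}.
Next Obligation.
by move=> X Y Z W H G F a b u; apply: assoc_natural.
Qed.

End CompositionNaturality.

Lemma iso_natural (C : Category) (a a' b b' : C) (p : Iso a b) (p' : Iso a' b')
    (u : Hom a a') (v : Hom b b') :
  v · p = p' · u -> u · iso_inv p = iso_inv p' · v.
Proof.
move=> e; rewrite -[LHS]comp_idl -(iso_homK p') -!comp_assoc.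
by rewrite [X in _ · X]comp_assoc -e -comp_assoc iso_invK comp_idr.
Qed.

Program Definition nt_assoc_inv (B : Bicategory) (C : Category) (X Y Z W : B)
    (H : Functor C (bhom Z W)) (G : Functor C (bhom Y Z))
    (F : Functor C (bhom X Y)) :
    NatTrans (hcompF (hcompF H G) F) (hcompF H (hcompF G F)) :=
  {| ntc := fun x => iso_inv (assoc (H x) (G x) (F x)) |}.
Next Obligation.
by move=> B C X Y Z W H G F a b u; apply: iso_natural; apply: assoc_natural.
Qed.

Section Pcomp.
Variables (B B' : Bicategory) (P : Pseudofunctor B B') (C : Category).
Variables (X Y Z : B) (G : Functor C (bhom Y Z)) (F : Functor C (bhom X Y)).

Program Definition nt_pcomp :
    NatTrans (hcompF (functor_comp (pmap P Y Z) G) (functor_comp (pmap P X Y) F))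
             (functor_comp (pmap P X Z) (hcompF G F)) :=
  {| ntc := fun x => pcomp P (G x) (F x) |}.
Next Obligation. by move=> a b u; apply: pcomp_natural. Qed.

Program Definition nt_pcomp_inv :
    NatTrans (functor_comp (pmap P X Z) (hcompF G F))
             (hcompF (functor_comp (pmap P Y Z) G) (functor_comp (pmap P X Y) F)) :=
  {| ntc := fun x => iso_inv (pcomp P (G x) (F x)) |}.
Next Obligation. by move=> a b u; apply: iso_natural; apply: pcomp_natural. Qed.

End Pcomp.

Section Iterates.
Variables (B B' : Bicategory) (G : Pseudofunctor B B').
Variables (n : nat) (X : 'I_n.+1 -> B).

Fixpoint beval (k l : 'I_n.+1) (s : biter k l) :
    Functor (path_cat X) (bhom (X k) (X l)) :=
  match s with
  | BLeaf i => pi_proj _ i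
  | BNode _ _ _ s t => hcompF (beval t) (beval s)
  end.

Fixpoint geval (k l : 'I_n.+1) (s : giter k l) :
    Functor (path_cat X) (bhom (G (X k)) (G (X l))) :=
  match s with
  | GLeaf k l s => functor_comp (pmap G (X k) (X l)) (beval s)
  | GNode _ _ _ s t => hcompF (geval t) (geval s)
  end.

Inductive bexpansion : forall (k l : 'I_n.+1) (s t : biter k l),
    NatTrans (beval s) (beval t) -> Prop :=
  | bexp_assoc (k i j l : 'I_n.+1) (r : biter k i) (s : biter i j)
      (t : biter j l) :
      @bexpansion _ _ (BNode (BNode r s) t) (BNode r (BNode s t))
        (nt_assoc (beval t) (beval s) (beval r))
  | bexp_assoc_inv (k i j l : 'I_n.+1) (r : biter k i) (s : biter i j)
      (t : biter j l) :
      @bexpansion _ _ (BNode r (BNode s t)) (BNode (BNode r s) t)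
        (nt_assoc_inv (beval t) (beval s) (beval r))
  | bexp_first (k j l : 'I_n.+1) (s s' : biter k j) (t : biter j l)
      (p : NatTrans (beval s) (beval s')) :
      bexpansion p ->
      @bexpansion _ _ (BNode s t) (BNode s' t)
        (nt_hcomp (nt_id (beval t)) p)
  | bexp_second (k j l : 'I_n.+1) (s : biter k j) (t t' : biter j l)
      (p : NatTrans (beval t) (beval t')) :
      bexpansion p ->
      @bexpansion _ _ (BNode s t) (BNode s t')
        (nt_hcomp p (nt_id (beval s))).

(* [exp_source] is the image under [G] of an expanded associator of [B]; the
   horizontal composites of [exp_first] and [exp_second] are taken in [B']. *)
Inductive expansion : forall (k l : 'I_n.+1) (s t : giter k l),
    NatTrans (geval s) (geval t) -> Prop :=
  | exp_source (k l : 'I_n.+1) (s t : biter k l)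
      (p : NatTrans (beval s) (beval t)) :
      bexpansion p ->
      @expansion _ _ (GLeaf s) (GLeaf t) (nt_image (pmap G (X k) (X l)) p)
  | exp_pcomp (k j l : 'I_n.+1) (s : biter k j) (t : biter j l) :
      @expansion _ _ (GNode (GLeaf s) (GLeaf t)) (GLeaf (BNode s t))
        (nt_pcomp G (beval t) (beval s))
  | exp_pcomp_inv (k j l : 'I_n.+1) (s : biter k j) (t : biter j l) :
      @expansion _ _ (GLeaf (BNode s t)) (GNode (GLeaf s) (GLeaf t))
        (nt_pcomp_inv G (beval t) (beval s))
  | exp_assoc (k i j l : 'I_n.+1) (r : giter k i) (s : giter i j)
      (t : giter j l) :
      @expansion _ _ (GNode (GNode r s) t) (GNode r (GNode s t))
        (nt_assoc (geval t) (geval s) (geval r))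
  | exp_assoc_inv (k i j l : 'I_n.+1) (r : giter k i) (s : giter i j)
      (t : giter j l) :
      @expansion _ _ (GNode r (GNode s t)) (GNode (GNode r s) t)
        (nt_assoc_inv (geval t) (geval s) (geval r))
  | exp_first (k j l : 'I_n.+1) (s s' : giter k j) (t : giter j l)
      (p : NatTrans (geval s) (geval s')) :
      expansion p ->
      @expansion _ _ (GNode s t) (GNode s' t)
        (nt_hcomp (nt_id (geval t)) p)
  | exp_second (k j l : 'I_n.+1) (s : giter k j) (t t' : giter j l)
      (p : NatTrans (geval t) (geval t')) :
      expansion p ->
      @expansion _ _ (GNode s t) (GNode s t')
        (nt_hcomp p (nt_id (geval s))).

Definition iter_cat (k l : 'I_n.+1) : Category := nat_cat (@geval k l).

Inductive canonical (k l : 'I_n.+1) :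
    forall s t : iter_cat k l, Hom s t -> Prop :=
  | can_id (s : iter_cat k l) : canonical (idc s)
  | can_expansion (s t : giter k l) (p : NatTrans (geval s) (geval t)) :
      expansion p -> @canonical k l s t p
  | can_comp (r s t : iter_cat k l) (q : Hom s t) (p : Hom r s) :
      canonical q -> canonical p -> canonical (q · p).

Definition canonical_iter_cat (k l : 'I_n.+1) : Category :=
  wide_subcat (@can_id k l) (@can_comp k l).

End Iterates.

Record collection (B : Type) := {
  mult : nat;
  mult_ge2 : 2 <= mult;
  vertex : 'I_mult.+1 -> B
}.

(* Objects are formal iterates: two parenthesizations are distinct objects even
   when they happen to denote the same functor.  Identifying them would be wrong:
   in a skeletal monoidal category given by a nontrivial 3-cocycle, the functors
   [h ∘ (g ∘ f)] and [(h ∘ g) ∘ f] coincide, but the associator is not the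
   identity. *)
Definition Cat_canonical (B B' : Bicategory) (G : Pseudofunctor B B') :
    Category :=
  coprod_cat (fun X : collection B =>
    canonical_iter_cat G (@vertex _ X) ord0 ord_max).

(* Main.v *)
(** Following the proof of Cayley's theorem, a [G]-iterate [s] is determined by
    the way it acts by composition on the 1-morphisms [m].  Composing [m]
    successively with the images under [G] of the single factors gives a
    1-morphism [gact s m], and reassociating gives a 2-isomorphism
    [gact s m => s ∘ m].  By the pentagon and the hexagon, whiskering any
    expansion [s => t] with [m] corresponds under these isomorphisms to an
    identity [gact s m = gact t m].  Hence two parallel canonical 2-morphisms
    agree after whiskering with [m]; whiskering with [m = id] is faithful. *)
From Stdlib Require Import ProofIrrelevance.
From mathcomp Require Import all_boot.
Require Import Defs.

Set Implicit Arguments.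
Unset Strict Implicit.
Unset Printing Implicit Defensive.

Local Open Scope cat_scope.

(** * Squares with one side a transported identity *)

Definition id_cast (C : Category) (a b : C) (e : a = b) : Hom a b :=
  match e with erefl => idc a end.

(** The equality of sources is existential because, for general iterates, it is only produced by the
    induction along the canonical 2-morphism. *)
Definition same_up_to_cast (C : Category) (a a' b b' : C) (f : Hom a b)
    (f' : Hom a' b') (p : Hom b b') : Prop :=
  exists e : a = a', p · f = f' · id_cast e.

(** Right inverses are preserved by every functor, hence by whiskering; mere epimorphisms need not
    be. *)
Definition split_epi (C : Category) (a b : C) (f : Hom a b) : Prop :=
  exists g, f · g = idc b.

Lemma split_epi_id (C : Category) (a : C) : split_epi (idc a).
Proof. by exists (idc a); rewrite comp_idl. Qed.

Lemma split_epi_iso (C : Category) (a b : C) (i : Iso a b) : split_epi i.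
Proof. by exists (iso_inv i); rewrite iso_invK. Qed.

Lemma split_epi_comp (C : Category) (a b c : C) (g : Hom b c) (f : Hom a b) :
  split_epi g -> split_epi f -> split_epi (g · f).
Proof.
move=> [g' hg] [f' hf]; exists (f' · g').
by rewrite comp_assoc -(comp_assoc g) hf comp_idr hg.
Qed.

Lemma split_epi_cancel (C : Category) (a b c : C) (f : Hom a b)
    (p q : Hom b c) :
  split_epi f -> p · f = q · f -> p = q.
Proof.
move=> [g hg] e; rewrite -[p]comp_idr -[q]comp_idr -hg !comp_assoc.
by rewrite e.
Qed.

(** The two equalities of sources agree by proof irrelevance, so [p] and [q] agree after composition
    with [f], which cancels. *)
Lemma same_up_to_cast_eq (C : Category) (a a' b b' : C) (f : Hom a b)
    (f' : Hom a' b') (p q : Hom b b') :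
  split_epi f -> same_up_to_cast f f' p -> same_up_to_cast f f' q -> p = q.
Proof.
move=> hf [e hp] [e' hq]; apply: (split_epi_cancel hf).
by rewrite hp hq (proof_irrelevance _ e e').
Qed.

Lemma same_up_to_cast_refl (C : Category) (a b b' : C) (f : Hom a b)
    (f' : Hom a b') (p : Hom b b') :
  p · f = f' -> same_up_to_cast f f' p.
Proof. by move=> e; exists erefl; rewrite comp_idr. Qed.

Lemma same_up_to_cast_comp (C : Category) (a a' a'' b b' b'' : C)
    (f : Hom a b) (f' : Hom a' b') (f'' : Hom a'' b'') (q : Hom b' b'')
    (p : Hom b b') :
  same_up_to_cast f' f'' q -> same_up_to_cast f f' p ->
  same_up_to_cast f f'' (q · p).
Proof.
move=> [e' hq] [e hp]; exists (etrans e e').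
rewrite -comp_assoc hp comp_assoc hq.
by case: _ / e' f'' q {hq} => f'' q /=; rewrite comp_idr.
Qed.

Lemma same_up_to_cast_square (C : Category) (a a' b b' c c' : C)
    (f : Hom a b) (f' : Hom a' b') (g : Hom b c) (g' : Hom b' c')
    (p : Hom b b') (q : Hom c c') :
  q · g = g' · p -> same_up_to_cast f f' p ->
  same_up_to_cast (g · f) (g' · f') q.
Proof.
by move=> hqg [e hp]; exists e; rewrite comp_assoc hqg -!comp_assoc hp.
Qed.

Lemma same_up_to_cast_inv (C : Category) (a a' b b' : C) (f : Hom a b)
    (f' : Hom a' b') (p : Hom b b') (q : Hom b' b) :
  q · p = idc b -> same_up_to_cast f f' p -> same_up_to_cast f' f q.
Proof.
move=> hqp [e]; case: _ / e f' => f' /=; rewrite comp_idr => hp.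
by apply: same_up_to_cast_refl; rewrite -hp comp_assoc hqp comp_idl.
Qed.

(** * Whiskering calculus *)

Section Whiskering.
Variable B : BicategoryData.

Lemma hcomp2_id (X Y Z : B) (g : bhom Y Z) (f : bhom X Y) :
  idc g ∗ idc f = idc (g ∘ f).
Proof. exact: (fmap_id (bcomp X Y Z)). Qed.

Lemma hcomp2_comp (X Y Z : B) (g g' g'' : bhom Y Z) (f f' f'' : bhom X Y)
    (b' : Hom g' g'') (b : Hom g g') (a' : Hom f' f'') (a : Hom f f') :
  (b' · b) ∗ (a' · a) = (b' ∗ a') · (b ∗ a).
Proof. by rewrite /hcomp2 -fmap_comp. Qed.

Lemma whiskerl_comp (X Y Z : B) (g : bhom Y Z) (f f' f'' : bhom X Y)
    (a' : Hom f' f'') (a : Hom f f') :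
  idc g ∗ (a' · a) = (idc g ∗ a') · (idc g ∗ a).
Proof. by rewrite -hcomp2_comp comp_idl. Qed.

Lemma whiskerr_comp (X Y Z : B) (g g' g'' : bhom Y Z) (f : bhom X Y)
    (b' : Hom g' g'') (b : Hom g g') :
  (b' · b) ∗ idc f = (b' ∗ idc f) · (b ∗ idc f).
Proof. by rewrite -hcomp2_comp comp_idl. Qed.

Lemma interchange (X Y Z : B) (g g' : bhom Y Z) (f f' : bhom X Y)
    (b : Hom g g') (a : Hom f f') :
  (idc g' ∗ a) · (b ∗ idc f) = (b ∗ idc f') · (idc g ∗ a).
Proof. by rewrite -!hcomp2_comp !comp_idl !comp_idr. Qed.

Lemma split_epi_whiskerl (X Y Z : B) (g : bhom Y Z) (f f' : bhom X Y)
    (a : Hom f f') :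
  split_epi a -> split_epi (idc g ∗ a).
Proof.
by move=> [a' ha]; exists (idc g ∗ a'); rewrite -whiskerl_comp ha hcomp2_id.
Qed.

Lemma split_epi_whiskerr (X Y Z : B) (g g' : bhom Y Z) (f : bhom X Y)
    (b : Hom g g') :
  split_epi b -> split_epi (b ∗ idc f).
Proof.
by move=> [b' hb]; exists (b' ∗ idc f); rewrite -whiskerr_comp hb hcomp2_id.
Qed.

End Whiskering.

(** Naturality of the right unitor recovers [p] from its whiskering. *)
Lemma whisker_bid_faithful (B : Bicategory) (X Y : B) (f g : bhom X Y)
    (p q : Hom f g) :
  p ∗ idc (bid X) = q ∗ idc (bid X) -> p = q.
Proof.
move=> e; apply: (split_epi_cancel (split_epi_iso (runit f))).
by rewrite !runit_natural e.
Qed.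

(** * The action of iterates on 1-morphisms *)

Section Action.
Variables (B B' : Bicategory) (G : Pseudofunctor B B').
Variables (n : nat) (X : 'I_n.+1 -> B) (x : path_cat X) (W : B').

Definition compose_with_image k l (s : biter k l) (m : bhom W (G (X k))) :
    bhom W (G (X l)) :=
  pmap G (X k) (X l) (beval X s x) ∘ m.

(** A composite in the source acts one factor at a time, not through its image under [G]. So both
    sides of an associator, or of [pcomp], act by convertible terms. *)
Fixpoint bact k l (s : biter k l) : bhom W (G (X k)) -> bhom W (G (X l)) :=
  match s with
  | BLeaf i => compose_with_image (BLeaf i)
  | BNode _ _ _ s t => fun m => bact t (bact s m)
  end.

Fixpoint gact k l (s : giter k l) : bhom W (G (X k)) -> bhom W (G (X l)) :=
  match s with
  | GLeaf _ _ s => bact s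
  | GNode _ _ _ s t => fun m => gact t (gact s m)
  end.

(** The path m'' => g ∘ m' => g ∘ (f ∘ m) => (g ∘ f) ∘ m. *)
Definition node_comparison (U V Z : B') (f : bhom U V) (g : bhom V Z)
    (m : bhom W U) (m' : bhom W V) (m'' : bhom W Z)
    (u : Hom m' (f ∘ m)) (v : Hom m'' (g ∘ m')) : Hom m'' ((g ∘ f) ∘ m) :=
  assoc g f m · (idc g ∗ u) · v.

Fixpoint bcomparison k l (s : biter k l) :
    forall m, Hom (bact s m) (pmap G (X k) (X l) (beval X s x) ∘ m) :=
  match s with
  | BLeaf i => fun m => idc (compose_with_image (BLeaf i) m)
  | BNode _ _ _ s t => fun m =>
      (pcomp G (beval X t x) (beval X s x) ∗ idc m) ·
      node_comparison (bcomparison s m) (bcomparison t (bact s m))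
  end.

Fixpoint gcomparison k l (s : giter k l) :
    forall m, Hom (gact s m) (geval G X s x ∘ m) :=
  match s with
  | GLeaf _ _ s => bcomparison s
  | GNode _ _ _ s t => fun m =>
      node_comparison (gcomparison s m) (gcomparison t (gact s m))
  end.

(** * Cancellation and coherence of the comparisons *)

Lemma split_epi_node (U V Z : B') (f : bhom U V) (g : bhom V Z)
    (m : bhom W U) (m' : bhom W V) (m'' : bhom W Z)
    (u : Hom m' (f ∘ m)) (v : Hom m'' (g ∘ m')) :
  split_epi u -> split_epi v -> split_epi (node_comparison u v).
Proof.
move=> hu hv; apply: split_epi_comp hv.
by apply: split_epi_comp (split_epi_iso _) (split_epi_whiskerl _ hu).
Qed.

Lemma split_epi_bcomparison k l (s : biter k l) m :
  split_epi (bcomparison s m).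
Proof.
elim: s m => [i|{}k j {}l s ihs t iht] m /=; first exact: split_epi_id.
apply: split_epi_comp (split_epi_node (ihs _) (iht _)).
exact: split_epi_whiskerr (split_epi_iso _).
Qed.

Lemma split_epi_gcomparison k l (s : giter k l) m :
  split_epi (gcomparison s m).
Proof.
elim: s m => [{}k {}l s|{}k j {}l s ihs t iht] m /=.
  exact: split_epi_bcomparison.
exact: split_epi_node (ihs _) (iht _).
Qed.

(** This is the pentagon for [h], [g], [f], [m], once naturality of the associator has moved [u]
    past [assoc h g]. *)
Lemma node_assoc (U V Y Z : B') (f : bhom U V) (g : bhom V Y) (h : bhom Y Z)
    (m : bhom W U) (m1 : bhom W V) (m2 : bhom W Y) (m3 : bhom W Z)
    (u : Hom m1 (f ∘ m)) (v : Hom m2 (g ∘ m1)) (w : Hom m3 (h ∘ m2)) :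
  (assoc h g f ∗ idc m) · node_comparison (node_comparison u v) w =
  node_comparison u (node_comparison v w).
Proof.
rewrite /node_comparison !whiskerl_comp !comp_assoc -pentagon.
congr (_ · _ · _); rewrite -!comp_assoc; congr (_ · _).
by rewrite -assoc_natural hcomp2_id.
Qed.

Lemma node_whiskerl (U V Z : B') (f f' : bhom U V) (g : bhom V Z)
    (m : bhom W U) (m' : bhom W V) (m'' : bhom W Z)
    (u : Hom m' (f ∘ m)) (v : Hom m'' (g ∘ m')) (p : Hom f f') :
  node_comparison ((p ∗ idc m) · u) v =
  ((idc g ∗ p) ∗ idc m) · node_comparison u v.
Proof.
by rewrite /node_comparison whiskerl_comp !comp_assoc assoc_natural.
Qed.

Lemma node_whiskerr (U V Z : B') (f : bhom U V) (g g' : bhom V Z)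
    (m : bhom W U) (m' : bhom W V) (m'' : bhom W Z)
    (u : Hom m' (f ∘ m)) (v : Hom m'' (g ∘ m')) (p : Hom g g') :
  node_comparison u ((p ∗ idc m') · v) =
  ((p ∗ idc f) ∗ idc m) · node_comparison u v.
Proof.
rewrite /node_comparison !comp_assoc assoc_natural hcomp2_id.
by rewrite -!(comp_assoc (assoc _ _ _)) interchange.
Qed.

(** Here [v] is a family: changing the first factor changes the 1-morphism on which the second one
    acts, and the cast must be carried through [act]. *)
Lemma node_first (U V Z : B') (f f' : bhom U V) (g : bhom V Z)
    (m : bhom W U) (m' m1' : bhom W V) (act : bhom W V -> bhom W Z)
    (u : Hom m' (f ∘ m)) (u' : Hom m1' (f' ∘ m))
    (v : forall m', Hom (act m') (g ∘ m')) (p : Hom f f') :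
  same_up_to_cast u u' (p ∗ idc m) ->
  same_up_to_cast (node_comparison u (v m')) (node_comparison u' (v m1'))
    ((idc g ∗ p) ∗ idc m).
Proof.
move=> [e]; case: _ / e u' => u' /=; rewrite comp_idr => hp.
by apply: same_up_to_cast_refl; rewrite -node_whiskerl hp.
Qed.

Lemma node_second (U V Z : B') (f : bhom U V) (g g' : bhom V Z)
    (m : bhom W U) (m' : bhom W V) (m'' m1'' : bhom W Z)
    (u : Hom m' (f ∘ m)) (v : Hom m'' (g ∘ m')) (v' : Hom m1'' (g' ∘ m'))
    (p : Hom g g') :
  same_up_to_cast v v' (p ∗ idc m') ->
  same_up_to_cast (node_comparison u v) (node_comparison u v')
    ((p ∗ idc f) ∗ idc m).
Proof.
move=> [e]; case: _ / e v' => v' /=; rewrite comp_idr => hp.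
by apply: same_up_to_cast_refl; rewrite -node_whiskerr hp.
Qed.

Lemma bexpansion_comparison k l (s t : biter k l)
    (p : NatTrans (beval X s) (beval X t)) (hp : bexpansion p) m :
  same_up_to_cast (bcomparison s m) (bcomparison t m)
    (fmap (pmap G (X k) (X l)) (p x) ∗ idc m).
Proof.
have assocP k' i j l' (r : biter k' i) (s' : biter i j) (t' : biter j l') m' :
    same_up_to_cast (bcomparison (BNode (BNode r s') t') m')
      (bcomparison (BNode r (BNode s' t')) m')
      (fmap (pmap G (X k') (X l'))
        (assoc (beval X t' x) (beval X s' x) (beval X r x)) ∗ idc m').
  apply: same_up_to_cast_refl => /=.
  (* The inner [pcomp] of each side is pulled out, and [node_assoc] introduces the associator of the
     target; what remains is the hexagon whiskered with [m']. *)
  rewrite node_whiskerl node_whiskerr -node_assoc.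
  move: (node_comparison (node_comparison _ _) _) => u.
  by rewrite !comp_assoc -!whiskerr_comp phexagon.
elim: hp m => {k l s t p}.
- by move=> k i j l r s t m; apply: assocP.
- move=> k i j l r s t m; apply: same_up_to_cast_inv (assocP _ _ _ _ r s t m).
  by rewrite -whiskerr_comp -fmap_comp iso_homK fmap_id hcomp2_id.
- move=> k j l s s' t p _ ih m.
  (* The required square is naturality of [pcomp], whiskered with [m]. *)
  apply: same_up_to_cast_square (node_first _ (ih m)).
  by rewrite -!whiskerr_comp pcomp_natural fmap_id.
- move=> k j l s t t' p _ ih m.
  apply: same_up_to_cast_square (node_second _ (ih _)).
  by rewrite -!whiskerr_comp pcomp_natural fmap_id.
Qed.

Lemma expansion_comparison k l (s t : giter k l)
    (p : NatTrans (geval G X s) (geval G X t)) (hp : expansion p) m :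
  same_up_to_cast (gcomparison s m) (gcomparison t m) (p x ∗ idc m).
Proof.
elim: hp m => {k l s t p}.
- by move=> k l s t p hp m; apply: bexpansion_comparison hp _.
(* Holds by computation: [bcomparison] of a node is the node comparison followed by the whiskered
   [pcomp]. *)
- by move=> k j l s t m; apply: same_up_to_cast_refl.
- move=> k j l s t m; apply: same_up_to_cast_refl => /=.
  by rewrite comp_assoc -whiskerr_comp iso_homK hcomp2_id comp_idl.
- by move=> k i j l r s t m; apply: same_up_to_cast_refl; apply: node_assoc.
- move=> k i j l r s t m; apply: same_up_to_cast_refl.
  rewrite /= -node_assoc comp_assoc -whiskerr_comp iso_homK.
  by rewrite hcomp2_id comp_idl.
- by move=> k j l s s' t p _ ih m; apply: (node_first (gcomparison t) (ih m)).
- by move=> k j l s t t' p _ ih m; apply: (node_second (gcomparison s m) (ih _)).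
Qed.

Lemma canonical_comparison k l (s t : iter_cat G X k l) (p : Hom s t)
    (hp : canonical p) m :
  same_up_to_cast (gcomparison s m) (gcomparison t m) (p x ∗ idc m).
Proof.
elim: hp => {s t p}.
- by move=> s; apply: same_up_to_cast_refl; rewrite /= hcomp2_id comp_idl.
- by move=> s t p hp; apply: expansion_comparison hp _.
- move=> r s t q p _ ihq _ ihp; rewrite /= whiskerr_comp.
  exact: same_up_to_cast_comp ihq ihp.
Qed.

End Action.

(** * Uniqueness of canonical 2-morphisms *)

Lemma canonical_unique (B B' : Bicategory) (G : Pseudofunctor B B') (n : nat)
    (X : 'I_n.+1 -> B) k l (s t : iter_cat G X k l) (p q : Hom s t) :
  canonical p -> canonical q -> p = q.
Proof.
(* This fixes [W] as [G (X k)] and [m] as its identity 1-morphism. *)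
move=> hp hq; apply: nat_trans_eq => x; apply: whisker_bid_faithful.
apply: same_up_to_cast_eq (split_epi_gcomparison x s _) _ _.
  exact: canonical_comparison hp _.
exact: canonical_comparison hq _.
Qed.

Theorem theorem3p1 (B B' : Bicategory) (G : Pseudofunctor B B')
    (hG : unitary G) (S T : Cat_canonical G) (p q : Hom S T) :
  p = q.
Proof.
case: S T p q => [X s] [Y t] [/= e p] [e' q].
(* Each morphism of the disjoint union carries its own equality of collections; these are identified
   before the 2-morphisms are compared. *)
rewrite (proof_irrelevance _ e' e) in q *; congr existT.
case: p q => [p hp] [q hq]; apply: sig_ext; exact: canonical_unique.
Qed.
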